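(* Let $m$ and $n$ be positive integers with $n$ odd, and let $q=2^m$. Let $L(x)=\sum_{i=0}^{m-1}a_ix^{2^i}$ with $a_i\in\mathbb{F}_q$ be such that $xL(x)+vx$ is a complete permutation polynomial over $\mathbb{F}_q$ for some $v\in\mathbb{F}_q\setminus\{0,1\}$, and let $g(x)\in\mathbb{F}_q[x]$ be the compositional inverse of $xL(x)+vx$ over $\mathbb{F}_q$. Writing $T=\mathrm{tr}(x)$, the following hold. (1) The polynomial \[\bar F(x)=\frac{x}{v}+\left(\frac{g(T)}{T}+\frac{1}{v}\right)x\,T^{q-1}\] is a complete permutation polynomial over $\mathbb{F}_{q^n}$. (2) For every $u\in\mathbb{F}_q^*$, the polynomial \begin{align*} \tilde F(x)&=\left(1+T^{q-1}\right)\sum_{j=0}^{m-1}\frac{u^{2^j-1}}{v^{2^{j+1}-1}}\left(\sum_{k=0}^{\frac{n-1}{2}}x^{q^{2k}}\right)^{2^j} +\left[T^{q-1}+\left(u^{1/2}g(T)T+T^{3/2}\right)^{q-1}\right]\left(\frac{x}{u}\right)^{1/2}\\ &\quad+\left(u^{1/2}g(T)T+T^{3/2}\right)^{q-1}\left[g(T)+u^{1/2}\sum_{j=0}^{m-1}\left(\frac{T}{u^{1/2}g(T)}+u^{1/2}g(T)\right)^{-(2^{j+1}-1)}\left(\sum_{k=0}^{\frac{n-1}{2}}x^{q^{2k}}\right)^{2^j}\right] \end{align*} is a complete permutation polynomial over $\mathbb{F}_{q^n}$.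
   Context: A polynomial $f\in\mathbb{F}_Q[x]$ is a permutation polynomial over $\mathbb{F}_Q$ if it induces a bijection of $\mathbb{F}_Q$; it is a complete permutation polynomial if both $f(x)$ and $f(x)+x$ are permutation polynomials. The compositional inverse of a permutation polynomial $f$ over $\mathbb{F}_Q$ is the polynomial $f^{-1}$ with $f(f^{-1}(x))\equiv f^{-1}(f(x))\equiv x\pmod{x^Q-x}$. $\mathrm{tr}(x)=\sum_{i=0}^{n-1}x^{q^i}$ is the trace from $\mathbb{F}_{q^n}$ to $\mathbb{F}_q$. In polynomials over $\mathbb{F}_{2^e}$ (here $e=nm$), $x^{1/2}$ denotes $x^{2^{e-1}}$ and $1/x$ denotes $x^{2^e-2}$ (so $1/0=0$); accordingly $y^{3/2}=y\cdot y^{1/2}$ and $y^{-k}=(1/y)^k$. *)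

(* Defs.v *)
From HB Require Import structures.
From mathcomp Require Import all_boot all_order all_algebra.

Set Implicit Arguments.
Unset Strict Implicit.
Unset Printing Implicit Defensive.

Import GRing.Theory.
Local Open Scope ring_scope.

Definition perm_poly (K : finFieldType) (f : {poly K}) : Prop :=
  bijective (fun x : K => f.[x]).

Definition complete_perm_poly (K : finFieldType) (f : {poly K}) : Prop :=
  perm_poly f /\ perm_poly (f + 'X).

(* Any representative modulo 'X^#|K| - 'X of the inverse is accepted; no bound
   is put on its degree. *)
Definition compositional_inverse (K : finFieldType) (f g : {poly K}) : Prop :=
  ('X^#|K| - 'X %| (f \Po g) - 'X) /\ ('X^#|K| - 'X %| (g \Po f) - 'X).

(* [e] is the degree over F_2 of the ambient field: on F_(2^e), [sqrt2 e] is the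
   square root and [inv2 e] is the inverse extended by 0 |-> 0 (for 1 < e).
   They are powers, so they apply to polynomials as well as to scalars. *)
Definition sqrt2 (R : nzRingType) (e : nat) (x : R) : R := x ^+ (2 ^ (e - 1))%N.

Definition inv2 (R : nzRingType) (e : nat) (x : R) : R := x ^+ (2 ^ e - 2)%N.

Definition trace_poly (K : nzRingType) (q n : nat) : {poly K} :=
  \sum_(i < n) 'X^(q ^ i)%N.

Definition even_trace_poly (K : nzRingType) (q n : nat) : {poly K} :=
  \sum_(0 <= k < ((n - 1) %/ 2).+1) 'X^(q ^ (2 * k))%N.

Definition linearized_poly (K : nzRingType) (m : nat) (a : 'I_m -> K) : {poly K} :=
  \sum_(i < m) a i *: 'X^(2 ^ i)%N.

(* [iota] is the inclusion of F_(2^m) in F_(2^(n * m)); [map_poly iota g \Po T]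
   is thus g(T) as a polynomial over the larger field. *)
Definition Fbar (F E : finFieldType) (iota : {rmorphism F -> E}) (m n : nat)
    (v : F) (g : {poly F}) : {poly E} :=
  let e := (n * m)%N in
  let q := (2 ^ m)%N in
  let T := trace_poly E q n in
  let gT := map_poly iota g \Po T in
  (iota v)^-1 *: 'X + (gT * inv2 e T + ((iota v)^-1)%:P) * 'X * T ^+ (q - 1).

Definition Ftilde (F E : finFieldType) (iota : {rmorphism F -> E}) (m n : nat)
    (v : F) (g : {poly F}) (u : F) : {poly E} :=
  let e := (n * m)%N in
  let q := (2 ^ m)%N in
  let T := trace_poly E q n in
  let S := even_trace_poly E q n in
  let gT := map_poly iota g \Po T in
  let ru := sqrt2 e (iota u) in
  let A := (ru *: gT * T + T * sqrt2 e T) ^+ (q - 1) in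
  let B := T * inv2 e (ru *: gT) + ru *: gT in
  (1 + T ^+ (q - 1))
    * (\sum_(j < m) (iota u ^+ (2 ^ j - 1) / iota v ^+ (2 ^ j.+1 - 1))
                      *: S ^+ (2 ^ j))
  + (T ^+ (q - 1) + A) * sqrt2 e ((iota u)^-1 *: 'X)
  + A * (gT + ru *: \sum_(j < m) inv2 e B ^+ (2 ^ j.+1 - 1) * S ^+ (2 ^ j)).

(* Main.v *)
(* Write [V y] for the sum of the [y ^+ (2 ^ j)], [j < m]. Each polynomial maps
   the fiber of the trace over [t] into the fiber over [g.[t]], and
   [t |-> g.[t]] and [t |-> g.[t] + t] are permutations of F, so injectivity only
   matters inside a fiber. There the polynomial has the form [c + d * w], where
   [w] has constant trace and [x = p * w ^+ 2 + b * w + k], with coefficients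
   in F depending only on [t]. Two solutions [w] with equal images differ by a
   root in F of a linearized quadratic, and the trace is injective on F because
   [n] is odd. For [Ftilde], [w] is either a square root or [V (S x / b)]; in
   the latter case the quadratic relation comes from [V y ^+ 2 + V y = y ^+ q + y]
   and [S x ^+ q + S x = x + tr x], and [tr w = 0] because [t / b] has the form
   [r ^+ 2 + r]. *)
Require Import Defs.
From HB Require Import structures.
From mathcomp Require Import all_boot all_order all_algebra all_field ring.
Import GRing.Theory.
Local Open Scope ring_scope.

(** The map [V]: the trace to F_2 on a field with [2 ^ m] elements, but applied below to elements of
    the larger field [E]. *)
Definition abs_trace (R : nzRingType) (m : nat) (x : R) : R :=
  \sum_(j < m) x ^+ (2 ^ j).

(** * Frobenius powers and Artin-Schreier identities in characteristic 2 *)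

Section Characteristic2.

Variables (R : comNzRingType) (pchar2 : 2%N \in [pchar R]).
Implicit Types x y : R.

Lemma exprD2n k x y : (x + y) ^+ (2 ^ k) = x ^+ (2 ^ k) + y ^+ (2 ^ k).
Proof. by apply: exprDn_pchar; rewrite pnatX pnatE // pchar2. Qed.

Lemma expr_sum2n k (I : Type) (r : seq I) (P : pred I) (f : I -> R) :
  (\sum_(i <- r | P i) f i) ^+ (2 ^ k) = \sum_(i <- r | P i) f i ^+ (2 ^ k).
Proof.
apply: (big_morph _ (exprD2n k)).
by rewrite expr0n expn_eq0.
Qed.

Lemma natrX2n k i : i%:R ^+ (2 ^ k) = i%:R :> R.
Proof.
elim: i => [|i IHi]; first by rewrite expr0n expn_eq0.
by rewrite -natr1 exprD2n IHi expr1n.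
Qed.

Lemma addr_eq0_pchar2 x y : (x + y == 0) = (x == y).
Proof. by rewrite addr_eq0 oppr_pchar2. Qed.

Lemma addrK_pchar2 x y : x + y + y = x.
Proof. by rewrite -addrA addrr_pchar2 // addr0. Qed.

Lemma abs_traceD m x y : abs_trace R m (x + y) = abs_trace R m x + abs_trace R m y.
Proof. by rewrite -big_split; apply: eq_bigr => j _; rewrite exprD2n. Qed.

Lemma abs_traceX m k x : abs_trace R m x ^+ (2 ^ k) = abs_trace R m (x ^+ (2 ^ k)).
Proof. by rewrite expr_sum2n; apply: eq_bigr => j _; rewrite exprAC. Qed.

Lemma abs_trace_artin_schreier m x :
  abs_trace R m (x ^+ 2 + x) = x ^+ (2 ^ m) + x.
Proof.
elim: m => [|m IHm]; first by rewrite /abs_trace big_ord0 addrr_pchar2.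
rewrite /abs_trace big_ord_recr /= -/(abs_trace R m _) IHm exprD2n.
by rewrite -exprM -expnS addrC addrA addrK_pchar2.
Qed.

Lemma artin_schreier_abs_trace m x :
  abs_trace R m x ^+ 2 + abs_trace R m x = x ^+ (2 ^ m) + x.
Proof. by rewrite (abs_traceX m 1) -abs_traceD abs_trace_artin_schreier. Qed.

End Characteristic2.

(** For [e = 1] the exponent is 0, and 0 ^ 0 = 1 differs from the inverse of 0; hence the bound on
    [e]. *)
Lemma finField_exprV (E : finFieldType) e (x : E) :
  (1 < e)%N -> #|E| = (2 ^ e)%N -> x ^+ (2 ^ e - 2) = x^-1.
Proof.
move=> e_gt1 card_E; have lt2: (2 < 2 ^ e)%N by rewrite (@leq_trans (2 ^ 2)) // leq_exp2l.
have [->|nz] := eqVneq x 0; first by rewrite expr0n subn_eq0 leqNgt lt2 invr0.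
apply: (mulIf nz); apply: (mulIf nz); rewrite mulVf // mul1r -!exprSr.
by rewrite -[in RHS](expf_card x) card_E -addn2 subnK // ltnW.
Qed.

Lemma sqrt2K (E : finFieldType) e (x : E) :
  (0 < e)%N -> #|E| = (2 ^ e)%N -> sqrt2 e x ^+ 2 = x.
Proof.
by move=> e_gt0 card_E; rewrite -exprM -expnSr subn1 prednK // -card_E expf_card.
Qed.

Lemma horner_sqrt2 (R : comNzRingType) e (p : {poly R}) x :
  (sqrt2 e p).[x] = sqrt2 e p.[x].
Proof. by rewrite horner_exp. Qed.

(* The rescaling by [b ^+ 2 / a] turns the weighted sums of [Ftilde] into
   multiples of [abs_trace], where the Artin-Schreier identities apply. *)
Lemma weighted_abs_trace (K : fieldType) m (a b s : K) : a != 0 -> b != 0 ->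
  \sum_(j < m) a ^+ (2 ^ j - 1) / b ^+ (2 ^ j.+1 - 1) * s ^+ (2 ^ j) =
  b / a * abs_trace K m (s / (b ^+ 2 / a)).
Proof.
move=> a_nz b_nz; rewrite mulr_sumr; apply: eq_bigr => j _.
rewrite expnS; have [k ->] : exists k, (2 ^ j)%N = k.+1.
  by exists (2 ^ j).-1; rewrite prednK ?expn_gt0.
rewrite mul2n doubleS !subn1 /= -addnn invf_div !exprMn exprVn expr2 exprMn !exprS.
rewrite exprD; have bk_nz : b ^+ k != 0 by rewrite expf_neq0.
by field; rewrite bk_nz b_nz a_nz.
Qed.

(** * The trace from [E] to [F] and its fibers *)

Section RelativeTrace.

Variables (m n : nat) (F E : finFieldType) (iota : {rmorphism F -> E}).
Hypotheses (m_gt0 : (0 < m)%N) (n_odd : odd n).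
Hypotheses (card_F : #|F| = (2 ^ m)%N) (card_E : #|E| = ((2 ^ m) ^ n)%N).

Let q := (2 ^ m)%N.
Let tr (x : E) := (trace_poly E q n).[x].
Let S (x : E) := (even_trace_poly E q n).[x].

Let pcharF : 2%N \in [pchar F].
Proof. exact: card_finPcharP card_F _. Qed.

Let pcharE : 2%N \in [pchar E].
Proof. by apply: (@card_finPcharP _ _ (m * n)); rewrite // expnM. Qed.

Let trE x : tr x = \sum_(i < n) x ^+ (q ^ i).
Proof. by rewrite /tr horner_sum; apply: eq_bigr => i _; rewrite hornerXn. Qed.

Let SE x : S x = \sum_(0 <= k < ((n - 1) %/ 2).+1) x ^+ (q ^ (2 * k)).
Proof. by rewrite /S horner_sum; apply: eq_bigr => i _; rewrite hornerXn. Qed.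

Lemma iota_exp_q t i : iota t ^+ (q ^ i) = iota t.
Proof.
elim: i => [|i IHi]; first by rewrite expr1.
by rewrite expnSr exprM IHi -rmorphXn /q -card_F expf_card.
Qed.

(** The polynomial ['X^q - 'X] has at most [q] roots, and the image of [F] already supplies [q]. *)
Lemma fixed_in_image z : z ^+ q = z -> exists t, z = iota t.
Proof.
move=> zq; suff /mapP [t _ ->] : z \in map iota (enum F) by exists t.
apply: contraT => z_notin.
have q_gt1 : (1 < q)%N by rewrite -[1%N](expn0 2) ltn_exp2l.
have p_size : size ('X^q - 'X : {poly E}) = #|F|.+1.
  by rewrite size_polyDl size_polyXn /q -?card_F // size_polyN size_polyX card_F.
have := @max_poly_roots E ('X^q - 'X) (z :: map iota (enum F)).
rewrite -size_poly_eq0 p_size /= size_map -cardE ltnn => H; apply: H => //.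
  apply/andP; split; first by rewrite rootE !hornerE zq subrr.
  apply/allP => _ /mapP [t _ ->].
  by rewrite rootE !hornerE -[q]expn1 iota_exp_q subrr.
by rewrite z_notin map_inj_uniq ?enum_uniq //; apply: fmorph_inj.
Qed.

Lemma trD x y : tr (x + y) = tr x + tr y.
Proof.
by rewrite !trE -big_split; apply: eq_bigr => i _; rewrite -expnM exprD2n.
Qed.

Lemma trZ t x : tr (iota t * x) = iota t * tr x.
Proof.
by rewrite !trE mulr_sumr; apply: eq_bigr => i _; rewrite exprMn iota_exp_q.
Qed.

Lemma tr_iota t : tr (iota t) = iota t.
Proof.
rewrite trE (eq_bigr (fun _ => iota t)); last by move=> i _; apply: iota_exp_q.
(* There are [n] equal terms, and an odd multiple of 1 is 1 in characteristic 2. *)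
rewrite sumr_const card_ord -(odd_double_half n) n_odd mulrS -muln2 mulrnA.
by rewrite mulr2n addrr_pchar2 // addr0.
Qed.

Lemma trX2n k x : tr (x ^+ (2 ^ k)) = tr x ^+ (2 ^ k).
Proof. by rewrite !trE expr_sum2n //; apply: eq_bigr => i _; rewrite exprAC. Qed.

Lemma tr_exp_q x i : tr (x ^+ (q ^ i)) = tr x.
Proof.
rewrite -expnM trX2n expnM; elim: i => [|i IHi]; first by rewrite expr1.
rewrite expnSr exprM IHi trE expr_sum2n //.
case: n card_E => [|n'] card_E'; first by rewrite !big_ord0.
(* The power [q] shifts the conjugates cyclically: the new last one is [x] itself. *)
rewrite big_ord_recr /= -exprM -expnSr -card_E' expf_card addrC big_ord_recl.
by rewrite expr1; congr (_ + _); apply: eq_bigr => j _; rewrite -exprM -expnSr.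
Qed.

Lemma tr_in_image x : exists t, tr x = iota t.
Proof. by apply: fixed_in_image; rewrite -trX2n -[X in _ ^+ X]expn1 tr_exp_q. Qed.

Lemma tr_abs_trace x : tr (abs_trace E m x) = abs_trace E m (tr x).
Proof.
rewrite /abs_trace (big_morph tr trD (id1 := 0)); last first.
  by rewrite -(rmorph0 iota) tr_iota.
by apply: eq_bigr => j _; rewrite trX2n.
Qed.

Lemma tr_even_trace x : tr (S x) = ((n - 1) %/ 2).+1%:R * tr x.
Proof.
rewrite SE (big_morph tr trD (id1 := 0)); last first.
  by rewrite -(rmorph0 iota) tr_iota.
rewrite (eq_bigr (fun _ => tr x)) => [|i _]; last exact: tr_exp_q.
by rewrite sumr_const_nat subn0 mulr_natl.
Qed.

(** The power [q] turns even conjugates into odd ones; together their indices run from 0 to [n], and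
    the conjugate of index [n], equal to [x], is the term beyond the trace. *)
Lemma even_trace_exp_q x : S x ^+ q + S x = x + tr x.
Proof.
have tele h : (\sum_(0 <= k < h) x ^+ (q ^ (2 * k))) ^+ q
    + \sum_(0 <= k < h) x ^+ (q ^ (2 * k)) = \sum_(i < 2 * h) x ^+ (q ^ i).
  elim: h => [|h IHh]; first by rewrite big_nil muln0 big_ord0 addr0 expr0n expn_eq0.
  rewrite big_nat_recr //= exprD2n // mulnS !big_ord_recr /= -IHh -exprM -expnSr.
  by rewrite -!addrA; congr (_ + _); rewrite addrCA [X in _ + X]addrC.
have n1 : (2 * ((n - 1) %/ 2).+1)%N = n.+1.
  have nE : n = n./2.*2.+1 by rewrite -[LHS]odd_double_half n_odd.
  by rewrite nE subn1 divn2 doubleK mulnS mul2n.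
by rewrite SE tele n1 big_ord_recr /= -card_E expf_card addrC trE.
Qed.


(** The powers [q - 1] in [Fbar] and [Ftilde] thus act as indicators that depend only on the
    fiber. *)
Lemma iota_exp_q_pred t : iota t ^+ (q - 1) = (t != 0)%:R.
Proof.
have q_gt1 : (1 < q)%N by rewrite -[1%N](expn0 2) ltn_exp2l.
have [->|nz] := eqVneq t 0; first by rewrite rmorph0 expr0n subn_eq0 leqNgt q_gt1.
have it_nz : iota t != 0 by rewrite fmorph_eq0.
apply: (mulIf it_nz); rewrite -exprSr -addn1 subnK 1?ltnW // mul1r.
by rewrite -[q]expn1 iota_exp_q.
Qed.

(* As n is odd, the trace is injective on the image of F, so the difference of
   two solutions in a common fiber, which lies in that image, vanishes. *)
Lemma fiber_quadratic_inj (p b : F) w w' :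
  (p != 0) || (b != 0) -> tr w = tr w' ->
  iota p * w ^+ 2 + iota b * w = iota p * w' ^+ 2 + iota b * w' -> w = w'.
Proof.
move=> pb_nz tr_eq /eqP; rewrite -(addr_eq0_pchar2 E pcharE) addrACA -!mulrDr.
rewrite -(exprD2n E pcharE 1); set d := w + w' => eq0.
apply/eqP; rewrite -(addr_eq0_pchar2 E pcharE) -/d; apply: contraT => d_nz.
have tr_d : tr d = 0 by rewrite trD tr_eq addrr_pchar2.
have : (iota p * d + iota b) * d == 0 by rewrite mulrDl -mulrA.
rewrite mulf_eq0 (negPf d_nz) orbF (addr_eq0_pchar2 E pcharE) => /eqP pd.
have [p0|p_nz] := eqVneq p 0.
  by move: pd pb_nz; rewrite p0 rmorph0 mul0r eqxx => /esym/eqP; rewrite fmorph_eq0 => ->.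
have ip_nz : iota p != 0 by rewrite fmorph_eq0.
have dE : d = iota (b / p) by rewrite fmorph_div -pd mulrAC mulfV ?mul1r.
by rewrite -tr_d dE tr_iota -dE eqxx in d_nz.
Qed.

(** As [s] is the trace of [w], the equation [c + d * s = G t] sends the fiber over [t] into that
    over [G t]. Inside a fiber, [d != 0] makes [h] injective, while [h + 'X] takes the value
    [p * w ^+ 2 + (d + b) * w] up to a constant. *)
Lemma complete_perm_poly_fiberwise (h : {poly E}) (G : F -> F) :
  injective G -> injective (fun t => G t + t) ->
  (forall t, exists p b d c k s : F,
    [/\ d != 0, (p != 0) || (d + b != 0), c + d * s = G t &
      forall x, tr x = iota t -> exists w,
        [/\ tr w = iota s, h.[x] = iota c + iota d * w &
            x = iota p * w ^+ 2 + iota b * w + iota k]]) ->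
  complete_perm_poly h.
Proof.
move=> G_inj GD_inj fiber.
have tr_h x t : tr x = iota t -> tr h.[x] = iota (G t).
  move=> xt; have [p [b [d [c [k [s [_ _ <- /(_ x xt) [w [tr_w -> _]]]]]]]]] := fiber t.
  by rewrite trD trZ tr_iota tr_w -rmorphM -rmorphD.
split; apply: injF_bij => x y.
  have [[t xt] [t' yt]] := (tr_in_image x, tr_in_image y) => hxy.
  have tt' : t = t'.
    by apply/G_inj/(fmorph_inj iota); rewrite -(tr_h x) // -(tr_h y) // hxy.
  subst t'; have [p [b [d [c [k [s [d_nz _ _ sol]]]]]]] := fiber t.
  have [w [_ hx ->]] := sol x xt; have [w' [_ hy ->]] := sol y yt.
  suff -> : w = w' by [].
  move: hxy; rewrite hx hy => /addrI /mulfI -> //.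
  by rewrite fmorph_eq0.
rewrite !hornerD !hornerX.
have [[t xt] [t' yt]] := (tr_in_image x, tr_in_image y) => hxy.
have tt' : t = t'.
  apply/GD_inj/(fmorph_inj iota); rewrite !rmorphD -(tr_h x) // -(tr_h y) //.
  by rewrite -xt -yt -!trD hxy.
subst t'; have [p [b [d [c [k [s [_ pb_nz _ sol]]]]]]] := fiber t.
have [w [tr_w hx xE]] := sol x xt; have [w' [tr_w' hy yE]] := sol y yt.
suff ww' : w = w' by rewrite xE yE ww'.
apply: (fiber_quadratic_inj p (d + b)) => //; first by rewrite tr_w.
move: hxy; rewrite hx hy xE yE -!addrA => /addrI; rewrite !addrA => /addIr.
by rewrite rmorphD !mulrDl !addrA ![iota p * _ + _]addrC.
Qed.

Lemma abs_trace_fiber (b r : F) x :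
  b != 0 -> tr x = iota (b * (r ^+ 2 + r)) ->
  let w := abs_trace E m (S x / iota b) in
  tr w = 0 /\ x = iota b * w ^+ 2 + iota b * w + tr x.
Proof.
move=> b_nz trx w; have ib_nz : iota b != 0 by rewrite fmorph_eq0.
split.
  rewrite /w tr_abs_trace mulrC -fmorphV trZ tr_even_trace trx.
  rewrite -(rmorph_nat iota); set N := _%:R.
  (* The number [N] of terms of [S] lies in the prime field, so [N ^+ 2 = N] and the factor is
     absorbed into [r]. *)
  have -> : iota b^-1 * (iota N * iota (b * (r ^+ 2 + r))) =
      iota (N * r) ^+ 2 + iota (N * r).
    rewrite -rmorphXn -rmorphD -!rmorphM exprMn (natrX2n F pcharF 1) -mulrDr.
    by rewrite [N * (b * _)]mulrCA mulKf.
  by rewrite abs_trace_artin_schreier // -[(2 ^ m)%N]expn1 iota_exp_q addrr_pchar2.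
rewrite -mulrDr artin_schreier_abs_trace // exprMn -fmorphV.
have -> : iota b^-1 ^+ (2 ^ m) = iota b^-1 by rewrite -[(2 ^ m)%N]expn1 iota_exp_q.
rewrite -mulrDl even_trace_exp_q.
by rewrite mulrC fmorphV mulfVK // addrK_pchar2.
Qed.

(** * The polynomials [Fbar] and [Ftilde] on the fibers *)

Section CompleteInverse.

Variables (v : F) (g : {poly F}).
Hypotheses (v_neq0 : v != 0) (v_neq1 : v != 1) (g0 : g.[0] = 0).
Hypotheses (g_inj : injective (fun t => g.[t])).
Hypotheses (gD_inj : injective (fun t => g.[t] + t)).

(** An element [v] other than 0 and 1 exists, so [F] is not F_2. *)
Let e_gt1 : (1 < n * m)%N.
Proof.
have m_gt1 : (1 < m)%N.
  rewrite ltn_neqAle m_gt0 andbT; apply/eqP => m1.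
  have := expf_card v; rewrite card_F -m1 expr2 -[X in _ = X]mulr1.
  by move/(mulfI v_neq0)/eqP; apply/negP.
by rewrite (leq_trans m_gt1) // leq_pmull // odd_gt0.
Qed.

Let card_E2 : #|E| = (2 ^ (n * m))%N.
Proof. by rewrite card_E -expnM mulnC. Qed.

Let g_neq0 t : t != 0 -> g.[t] != 0.
Proof. by apply: contra_neq => gt0; apply: g_inj; rewrite gt0. Qed.

Let horner_g x t : tr x = iota t ->
  (map_poly iota g \Po trace_poly E q n).[x] = iota g.[t].
Proof. by move=> xt; rewrite horner_comp -/(tr x) xt horner_map. Qed.

(** On the fiber over [t], [Fbar] is multiplication by 1/v if t = 0 and by g(t)/t otherwise, so
    [w = x] serves; the factor must differ from 0 and 1. *)
Lemma Fbar_complete : complete_perm_poly (Fbar iota m n v g).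
Proof.
have hx x t : tr x = iota t -> (Fbar iota m n v g).[x] =
    (iota v)^-1 * x + (iota g.[t] / iota t + (iota v)^-1) * x * (t != 0)%:R.
  move=> xt; rewrite /Fbar hornerD hornerZ hornerX !hornerM hornerD hornerM.
  by rewrite (horner_g x t xt) /inv2 horner_exp finField_exprV // hornerC hornerX horner_exp
    -/q -/(tr x) xt iota_exp_q_pred.
apply: (complete_perm_poly_fiberwise _ _ g_inj gD_inj) => t.
have [t0|t_nz] := eqVneq t 0.
  exists 0, 1, v^-1, 0, 0, 0; split.
  - by rewrite invr_eq0.
  - by rewrite addr_eq0_pchar2 // invr_eq1 v_neq1 orbT.
  - by rewrite t0 g0 mulr0 addr0.
  - move=> x xt; exists x; rewrite (hx _ _ xt) xt t0 eqxx mulr0 addr0.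
    by rewrite !rmorph0 rmorph1 fmorphV mul0r mul1r !add0r addr0.
exists 0, 1, (g.[t] / t), 0, 0, t; split.
- by rewrite mulf_neq0 ?invr_eq0 ?g_neq0.
- apply/orP; right; rewrite addr_eq0_pchar2 // -(inj_eq (mulIf t_nz)) divfK // mul1r.
  (* If g(t) = t, then g(t) + t = 0, a value already taken at 0. *)
  apply: contra_neq t_nz => gt; apply: gD_inj.
  by rewrite gt g0 addr0 addrr_pchar2.
- by rewrite add0r mulfVK.
- move=> x xt; exists x; rewrite (hx _ _ xt) xt t_nz mulr1.
  rewrite !rmorph0 rmorph1 fmorph_div mul0r mul1r !add0r addr0; split=> //.
  by rewrite -mulrDl addrCA addrr_pchar2 // addr0.
Qed.

(** Exactly one of the three summands survives on each fiber: the first if t = 0, the second if t is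
    nonzero and [A t = 0], the third if [A t] is nonzero. *)
Lemma Ftilde_complete u : u != 0 -> complete_perm_poly (Ftilde iota m n v g u).
Proof.
move=> u_nz; set r := sqrt2 (n * m) u.
have iru : sqrt2 (n * m) (iota u) = iota r by rewrite /r /sqrt2 rmorphXn.
have e_gt0 : (0 < n * m)%N by apply: ltnW.
have sqr_r : r ^+ 2 = u.
  by apply: (fmorph_inj iota); rewrite rmorphXn -iru sqrt2K.
have r_nz : r != 0 by apply: contra_neq u_nz => r0; rewrite -sqr_r r0 expr0n.
pose s t := sqrt2 (n * m) t : F.
have sqr_s t : s t ^+ 2 = t.
  by apply: (fmorph_inj iota); rewrite rmorphXn /s /sqrt2 rmorphXn sqrt2K.
pose A t := r * g.[t] * t + t * s t.
pose B t := t / (r * g.[t]) + r * g.[t].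
have hx x t : tr x = iota t -> (Ftilde iota m n v g u).[x] =
    (1 + (t != 0)%:R) * (iota (v / u) * abs_trace E m (S x / iota (v ^+ 2 / u)))
    + ((t != 0)%:R + (A t != 0)%:R) * sqrt2 (n * m) ((iota u)^-1 * x)
    + (A t != 0)%:R * (iota g.[t] + iota r *
       \sum_(j < m) 1 ^+ (2 ^ j - 1) / iota (B t) ^+ (2 ^ j.+1 - 1) * S x ^+ (2 ^ j)).
  move=> xt; rewrite /Ftilde iru -/q; cbv zeta.
  set T := trace_poly E q n; set W := even_trace_poly E q n.
  have xT : T.[x] = iota t by [].
  have sT : sqrt2 (n * m) (iota t) = iota (s t) by rewrite /s /sqrt2 rmorphXn.
  set PA := (iota r *: _ * T + _) ^+ (q - 1).
  have hA : PA.[x] = (A t != 0)%:R.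
    rewrite horner_exp hornerD !hornerM hornerZ (horner_g x t xt) horner_sqrt2 xT sT.
    by rewrite -!rmorphM -rmorphD iota_exp_q_pred.
  set PB := T * inv2 (n * m) _ + _.
  have hB : PB.[x] = iota (B t).
    rewrite hornerD hornerM /inv2 horner_exp finField_exprV // hornerZ (horner_g x t xt) xT.
    by rewrite -rmorphM -fmorph_div -rmorphD.
  clearbody PA PB; rewrite 2!hornerD; congr (_ + _ + _).
  - rewrite hornerM hornerD hornerC horner_exp xT iota_exp_q_pred; congr (_ * _).
    rewrite fmorph_div [iota (_ / u)]fmorph_div rmorphXn.
    rewrite -weighted_abs_trace ?fmorph_eq0 // horner_sum.
    by apply: eq_bigr => j _; rewrite hornerZ horner_exp.
  - rewrite hornerM hornerD horner_exp xT iota_exp_q_pred hA horner_sqrt2.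
    by rewrite hornerZ hornerX.
  - rewrite hornerM hA hornerD hornerZ (horner_g x t xt) horner_sum.
    congr (_ * (_ + _ * _)); apply: eq_bigr => j _.
    by rewrite hornerM /inv2 !horner_exp finField_exprV // hB expr1n mul1r exprVn.
apply: (complete_perm_poly_fiberwise _ _ g_inj gD_inj) => t.
have [t0|t_nz] := eqVneq t 0.
  have b_nz : v ^+ 2 / u != 0 by rewrite mulf_neq0 ?expf_neq0 ?invr_eq0.
  (* These come from [weighted_abs_trace] with weights [u] and [v]. *)
  exists (v ^+ 2 / u), (v ^+ 2 / u), (v / u), 0, 0, 0; split.
  - by rewrite mulf_neq0 ?invr_eq0.
  - by rewrite b_nz.
  - by rewrite t0 g0 mulr0 addr0.
  - move=> x xt; have [] := abs_trace_fiber (v ^+ 2 / u) 0 x b_nz.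
      by rewrite xt t0 expr0n addr0 mulr0.
    move=> tr_w xE; exists (abs_trace E m (S x / iota (v ^+ 2 / u))); split.
    + by rewrite tr_w rmorph0.
    + rewrite (hx x t xt) t0 /A g0 !(mulr0, mul0r, addr0) eqxx /= !(mulr0n, mul0r, addr0).
      by rewrite mul1r rmorph0 add0r.
    + by rewrite [LHS]xE xt t0.
have [A0|A_nz] := eqVneq (A t) 0.
  have ug2 : u * g.[t] ^+ 2 = t.
    move/eqP: A0; rewrite /A [r * _ * t]mulrC -mulrDr mulf_eq0 (negPf t_nz) /=.
    by rewrite addr_eq0_pchar2 // => /eqP rg; rewrite -sqr_r -exprMn rg sqr_s.
  (* Here [w] is the image itself, the square root of x/u; its trace is g(t) because [u * g.[t] ^+ 2
     = t]. *)
  exists u, 0, 1, 0, 0, g.[t]; split.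
  - exact: oner_neq0.
  - by rewrite u_nz.
  - by rewrite add0r mul1r.
  - move=> x xt; exists (sqrt2 (n * m) ((iota u)^-1 * x)); split.
    + apply/eqP; rewrite -(addr_eq0_pchar2 E pcharE) -[_ == 0](expf_eq0 _ 2) /=.
      rewrite (exprD2n E pcharE 1) -(trX2n 1) sqrt2K // -fmorphV trZ xt.
      by rewrite -rmorphM -{1}ug2 mulKf // rmorphXn addrr_pchar2.
    + rewrite (hx x t xt) A0 eqxx t_nz addrr_pchar2 // !mul0r add0r addr0.
      by rewrite addr0 rmorph0 rmorph1 add0r.
    + by rewrite sqrt2K // rmorph0 mul0r !addr0 mulVKf // fmorph_eq0.
have rg_nz : r * g.[t] != 0 by rewrite mulf_neq0 ?g_neq0.
set z := r * g.[t] in rg_nz.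
have BzE : B t * z = t + z ^+ 2 by rewrite mulrDl divfK.
(* If [B t = 0], then [t = z ^+ 2], which forces the square of [A t] to vanish. *)
have B_nz : B t != 0.
  apply: contra_neq A_nz => B0; have tz : t = z ^+ 2.
    by apply/eqP; rewrite -(addr_eq0_pchar2 F pcharF) -BzE B0 mul0r.
  apply/eqP; rewrite -[_ == 0](expf_eq0 _ 2) /A -/z (exprD2n F pcharF 1).
  rewrite [(z * t) ^+ _]exprMn [(t * _) ^+ _]exprMn -[(2 ^ 1)%N]/2%N.
  by rewrite sqr_s [in X in X + _]mulrC -tz addrr_pchar2.
(* Dividing [t = z ^+ 2 + B t * z] by [B t ^+ 2] yields the form required by [abs_trace_fiber], with
   [z / B t] as its [r]. *)
have tB : t = B t ^+ 2 * ((z / B t) ^+ 2 + z / B t).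
  have zB : B t * (z / B t) = z by rewrite mulrC divfK.
  rewrite mulrDr -exprMn zB [B t ^+ 2]expr2 -[_ * (z / _)]mulrA zB BzE.
  by rewrite addrCA addrr_pchar2 // addr0.
have b_nz : B t ^+ 2 != 0 by rewrite expf_neq0.
(* The weights are now 1 and [B t], and the outer factor [r] enters [d]. *)
exists (B t ^+ 2), (B t ^+ 2), (r * B t), g.[t], t, 0; split.
- by rewrite mulf_neq0.
- by rewrite b_nz.
- by rewrite mulr0 addr0.
- move=> x xt; have [] := abs_trace_fiber (B t ^+ 2) (z / B t) x b_nz.
    by rewrite -tB.
  move=> tr_w xE; exists (abs_trace E m (S x / iota (B t ^+ 2))); split.
  + by rewrite tr_w rmorph0.
  + rewrite (hx x t xt) A_nz t_nz !addrr_pchar2 // !mul0r !add0r mul1r.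
    rewrite weighted_abs_trace ?oner_eq0 ?fmorph_eq0 // !divr1 -rmorphXn.
    by rewrite mulrA -rmorphM.
  + by rewrite -xt.
Qed.

End CompleteInverse.

End RelativeTrace.

(** * From congruences of polynomials to the theorem *)

Lemma horner_mod_card (K : finFieldType) (p : {poly K}) x :
  'X^#|K| - 'X %| p - 'X -> p.[x] = x.
Proof.
case/dvdpP => c /(congr1 (fun p => p.[x])).
by rewrite hornerM !hornerE expf_card subrr mulr0 => /eqP; rewrite subr_eq0 => /eqP.
Qed.

Theorem theorem10 (m n : nat) (m_gt0 : (0 < m)%N) (n_gt0 : (0 < n)%N)
  (n_odd : odd n)
  (F E : finFieldType) (iota : {rmorphism F -> E})
  (cardF : #|F| = (2 ^ m)%N) (cardE : #|E| = ((2 ^ m) ^ n)%N)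
  (a : 'I_m -> F) (v : F) (v_neq0 : v != 0) (v_neq1 : v != 1)
  (f_cpp : complete_perm_poly ('X * linearized_poly a + v *: 'X))
  (g : {poly F})
  (g_inv : compositional_inverse ('X * linearized_poly a + v *: 'X) g) :
  complete_perm_poly (Fbar iota m n v g) /\
  (forall u : F, u != 0 -> complete_perm_poly (Ftilde iota m n v g u)).
Proof.
set f := 'X * _ + _ in f_cpp g_inv; have [fgX gfX] := g_inv.
have fgK t : f.[g.[t]] = t by rewrite -horner_comp horner_mod_card.
have gfK t : g.[f.[t]] = t by rewrite -horner_comp horner_mod_card.
have g0 : g.[0] = 0.
  suff f0 : f.[0] = 0 by rewrite -{1}f0 gfK.
  by rewrite hornerD hornerM hornerZ hornerX mul0r mulr0 addr0.
have g_inj : injective (fun t => g.[t]) by apply: can_inj fgK.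
have gD_inj : injective (fun t => g.[t] + t).
  have fD_inj := bij_inj f_cpp.2.
  move=> t t' eq_gD; apply: g_inj; apply: fD_inj.
  (* The map g(s) + s is [f + 'X] composed with [g], since f(g(s)) = s. *)
  have fDE s : (f + 'X).[g.[s]] = g.[s] + s by rewrite hornerD hornerX fgK addrC.
  by rewrite !fDE.
split=> [|u]; first exact: Fbar_complete.
exact: Ftilde_complete.
Qed.
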